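(* Let $N>5040$ be an integer, and let $p>\log N$ be a prime that is not a factor of $N$. If $$\log N<p-\frac{1}{2}\log p+\frac{1}{2}-\frac{1}{\log p+1},$$ then $G(N)>G(Np)$.
   Context: $\log$ is the natural logarithm, $\sigma(n)=\sum_{d\mid n}d$, and $G(n)=\dfrac{\sigma(n)}{n\log\log n}$. *)

(* Defs.v *)
From HB Require Import structures.
From mathcomp Require Import all_boot all_order all_algebra.
From mathcomp Require Import reals exp.

Set Implicit Arguments.
Unset Strict Implicit.
Unset Printing Implicit Defensive.

Import Order.TTheory GRing.Theory Num.Theory.
Local Open Scope ring_scope.

Definition sigma (n : nat) : nat := (\sum_(d <- divisors n) d)%N.

(* [ln x = 0] for [x <= 0] and [0^-1 = 0], so [G] is total; it is the
   usual Gronwall function for n >= 3, where [0 < ln (ln n)]. *)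
Definition G (R : realType) (n : nat) : R :=
  (sigma n)%:R / (n%:R * ln (ln n%:R)).

(* Main.v *)
Require Import Defs.
From HB Require Import structures.
From mathcomp Require Import all_boot all_order all_algebra.
From mathcomp Require Import reals exp.
From mathcomp Require Import classical_sets topology normedtype derive.
From mathcomp Require Import ring lra.

Set Implicit Arguments.
Unset Strict Implicit.
Unset Printing Implicit Defensive.

Import Order.TTheory GRing.Theory Num.Theory.
Import numFieldNormedType.Exports.
Local Open Scope ring_scope.

(** As [p] does not divide [N], [sigma (N * p) = sigma N * (p + 1)].  Writing
    [L = ln N] and [q = ln p], the inequality [G (N * p) < G N] thus amounts
    to [(p + 1) * ln L < p * ln (L + q)], that is to
    [ln L < p * ln (1 + q / L)].  Two classical bounds on the logarithm
    separate the two sides: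
    - concavity bounds the left side by the tangent at [p],
      [ln L <= q - (p - L) / p];
    - the bound [2 * (u - 1) / (u + 1) <= ln u] at [u = 1 + q / L] gives
      [2 * p * q / (2 * L + q) <= p * ln (1 + q / L)].
    The hypothesis reads [L < p - a] with [a = (q^2 + 1) / (2 * (q + 1))], and
    then [2 * L + q < 2 * p + (q - 1) / (q + 1)].  To first order in [1 / p]
    it remains to compare [q - a / p] with
    [q - q * (q - 1) / (2 * p * (q + 1))], which is [q^2 - q <= q^2 + 1]. *)

(** The divisors of [N * p] that [p] divides are the [d * p] with [d] dividing
    [N]; the others are coprime to [p], hence divide [N]. *)
Lemma divisors_mul_prime (N p : nat) : (0 < N)%N -> prime p -> ~~ (p %| N)%N ->
  perm_eq (divisors (N * p)) (divisors N ++ [seq (d * p)%N | d <- divisors N]).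
Proof.
move=> N0 pp pN; have p0 := prime_gt0 pp.
have Np0 : (0 < N * p)%N by rewrite muln_gt0 N0.
apply: uniq_perm; first exact: divisors_uniq.
  rewrite cat_uniq divisors_uniq map_inj_uniq ?divisors_uniq ?andbT /=.
    apply/hasPn => _ /mapP[d _ ->] /=; rewrite -dvdn_divisors //.
    by apply: contra pN; apply: dvdn_trans; exact: dvdn_mull.
  by move=> x y /eqP; rewrite eqn_pmul2r // => /eqP.
move=> d; rewrite mem_cat -!dvdn_divisors //.
apply/idP/orP => [dNp | [dN | /mapP[e + ->]]].
- case: (boolP (p %| d)%N) => [/dvdnP[e de] | pd].
    right; apply/mapP; exists e => //.
    by rewrite -dvdn_divisors // -(dvdn_pmul2r p0) -de.
  by left; rewrite -(@Gauss_dvdl d N p) // coprime_sym prime_coprime.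
- exact: dvdn_mulr.
- by rewrite -dvdn_divisors // dvdn_pmul2r.
Qed.

Lemma sigma_mul_prime (N p : nat) : (0 < N)%N -> prime p -> ~~ (p %| N)%N ->
  sigma (N * p) = (sigma N * p.+1)%N.
Proof.
move=> N0 pp pN; rewrite /sigma (perm_big _ (divisors_mul_prime N0 pp pN)).
by rewrite big_cat big_map -big_distrl mulnS.
Qed.

Section LnBounds.
Variable R : realType.
Implicit Types u p L : R.

Lemma ln_le_subr1 u : 0 < u -> ln u <= u - 1.
Proof.
move=> u0; rewrite -{1}(subrKC 1 u); apply: le_ln1Dx.
by rewrite ltrBrDr addNr.
Qed.

Lemma ln_ge_1subV u : 0 < u -> 1 - u^-1 <= ln u.
Proof.
move=> u0; have ui0 : 0 < u^-1 by rewrite invr_gt0.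
have := ln_le_subr1 ui0; rewrite lnV ?posrE //; lra.
Qed.

(** The function [(u + 1) * ln u - 2 * (u - 1)] vanishes at [1], and its
    derivative [ln u - (1 - 1 / u)] is nonnegative.  The error of the bound at
    [1] is of third order in [u - 1]; the second-order term is the one that
    competes with [a / p] above, so the tangent bound would be too weak. *)
Lemma mulD1_ln_ge u : 1 <= u -> 2 * (u - 1) <= (u + 1) * ln u.
Proof.
move=> u1.
pose f (x : R) : R := (x + 1) * ln x - 2 * (x - 1).
pose df (x : R) : R := ln x - (1 - x^-1).
have dfP (x : R) : 0 < x -> is_derive x 1 f (df x).
  move=> x0; have lnx := is_derive1_ln x0.
  apply: is_derive_eq; rewrite /df /GRing.scale /=; field.
  by rewrite gt_eqF.
have fcont : {within `[1, u], continuous f}%classic.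
  apply: derivable_within_continuous => x; rewrite in_itv /= => /andP[x1 _].
  by have [] := dfP x (lt_le_trans ltr01 x1).
have dfI (x : R) : x \in `]1, u[ -> is_derive x 1 f (df x).
  by rewrite in_itv /= => /andP[x1 _]; apply: dfP; apply: lt_trans x1.
have [c] := MVT_segment u1 dfI fcont.
rewrite in_itv /= => /andP[c1 _].
have dfc : 0 <= df c by rewrite subr_ge0 ln_ge_1subV // (lt_le_trans ltr01).
have := mulr_ge0 dfc (_ : 0 <= u - 1); rewrite subr_ge0 => /(_ u1) h fE.
by move: h; rewrite -fE /f ln1; lra.
Qed.

(** The real form of the theorem, with [L] in the place of [ln N]: the gap
    between the two bounds has numerator
    [2 * p * (q + 1)^2 + (q^2 + 1) * (q - 1)], which is positive also for
    [q < 1] since then [(q^2 + 1) * (1 - q) < 2]. *)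
Lemma ln_lt_mul_ln1D p L : 1 < p -> 0 < L ->
  L < p - 1 / 2 * ln p + 1 / 2 - 1 / (ln p + 1) ->
  ln L < p * ln (1 + ln p / L).
Proof.
move=> p1 L0; have q0 := ln_gt0 p1; have p0 : 0 < p by lra.
have qL0 : 0 < ln p / L by rewrite divr_gt0.
have := @mulD1_ln_ge (1 + ln p / L); rewrite lerDl (ltW qL0) => /(_ isT).
have := ln_le_subr1 (divr_gt0 L0 p0); rewrite ln_div ?posrE //.
clear qL0; move: (ln p) (ln L) (ln (1 + _)) q0 => q l m q0 tangent pade LT.
set a : R := (q ^+ 2 + 1) / (2 * (q + 1)).
have Lpa : L < p - a.
  suff -> : p - a = p - 1 / 2 * q + 1 / 2 - 1 / (q + 1) by [].
  by rewrite /a; field; lra.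
have lt1 : l < q - a / p.
  apply: (@le_lt_trans _ _ (q + (L / p - 1))); first lra.
  suff : L / p < (p - a) / p by rewrite mulrBl divff; lra.
  by rewrite ltr_pM2r ?invr_gt0.
have D0 : 0 < 2 * L + q by lra.
(* the bound at 1 + q / L, cleared of denominators *)
have pade' : 2 * q <= (2 * L + q) * m.
  suff : L * (2 * (1 + q / L - 1)) <= L * ((1 + q / L + 1) * m).
    have -> : L * (2 * (1 + q / L - 1)) = 2 * q by field; lra.
    by have -> : L * ((1 + q / L + 1) * m) = (2 * L + q) * m by field; lra.
  by rewrite ler_pM2l.
apply: (lt_le_trans lt1); rewrite -(ler_pM2l D0).
apply: (@le_trans _ _ (p * (2 * q))); last first.
  by rewrite [leRHS]mulrCA ler_pM2l.
(* A negative left factor is trivial; otherwise it may be enlarged. *)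
have [s0|s0] := leP (q - a / p) 0.
  apply: (@le_trans _ _ 0); last by rewrite !mulr_ge0 //; lra.
  by rewrite mulr_ge0_le0 // ltW.
apply: (@le_trans _ _ ((2 * (p - a) + q) * (q - a / p))).
  by rewrite ler_pM2r //; lra.
rewrite -subr_ge0.
have -> : p * (2 * q) - (2 * (p - a) + q) * (q - a / p) =
    (2 * p * (q + 1) ^+ 2 + (q ^+ 2 + 1) * (q - 1)) / (2 * p * (q + 1) ^+ 2).
  by rewrite /a; field; rewrite !gt_eqF //; lra.
by apply: divr_ge0; nra.
Qed.

End LnBounds.

Theorem theorem11 (R : realType) (N p : nat)
    (hN : (5040 < N)%N)
    (hp : prime p)
    (hpN : ln (N%:R : R) < p%:R)
    (hndvd : ~~ (p %| N)%N)
    (hlog : ln (N%:R : R) <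
            p%:R - 1 / 2 * ln p%:R + 1 / 2 - 1 / (ln p%:R + 1)) :
  G R N > G R (N * p)%N.
Proof.
have N0 : (0 < N)%N by apply: leq_trans hN.
have sN0 : (0 < sigma N)%N by rewrite /sigma (big_rem 1%N) ?divisor1.
have p1 : 1 < p%:R :> R by rewrite ltr1n prime_gt1.
have NR0 : 0 < N%:R :> R by rewrite ltr0n.
have L1 : 1 < ln N%:R :> R.
  (* ln 4 = 2 * ln 2 >= 2 * (1 - 1 / 2) *)
  have ln4 : 1 <= ln (2 * 2) :> R.
    have := @ln_ge_1subV R 2 (ltr0n _ 2); rewrite lnM ?posrE //; lra.
  apply: le_lt_trans ln4 _; rewrite ltr_ln ?posrE //; last by rewrite mulr_gt0.
  rewrite -natrM ltr_nat.
  exact: leq_trans hN.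
have q0 := ln_gt0 p1.
have L0 : 0 < ln N%:R :> R by lra.
have key := ln_lt_mul_ln1D p1 L0 hlog.
have lnD : ln (ln N%:R + ln p%:R) = ln (ln N%:R) + ln (1 + ln p%:R / ln N%:R) :> R.
  rewrite -[RHS]lnM ?posrE ?addr_gt0 ?divr_gt0 //.
  by rewrite mulrDr mulr1 mulrCA divff ?mulr1 // gt_eqF.
have l0 := ln_gt0 L1.
have l'0 : 0 < ln (ln N%:R + ln p%:R) :> R by apply: ln_gt0; lra.
rewrite /G sigma_mul_prime // !natrM lnM ?posrE //; last lra.
rewrite ltr_pdivrMr ?mulr_gt0 //; last lra.
set s : R := (sigma N)%:R; set l : R := ln (ln _).
have -> : s / (N%:R * l) * (N%:R * p%:R * ln (ln N%:R + ln p%:R)) =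
    s * (p%:R * ln (ln N%:R + ln p%:R) / l).
  by field; rewrite !gt_eqF.
rewrite ltr_pM2l ?ltr0n // ltr_pdivlMr // lnD -/l -natr1.
by rewrite mulrDl mul1r mulrDr ltrD2l.
Qed.
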